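(* Let $T$ be a weakly reducible nonnegative tensor of order $m$ and dimension $n$, and let $\{I_1,\ldots,I_k\}$ be a partition of $\{1,\ldots,n\}$ into sets with weakly irreducible induced tensors obtained by the recursive block-triangularization procedure described in the context. Then $\rho(T)=\rho(T_{I_p})$ for some $p\in\{1,\ldots,k\}$.
   Context: Throughout $m,n\ge 2$ (induced tensors may have dimension one). A tensor $T$ of order $m$ and dimension $n$ is a real array $(T_{i_1\ldots i_m})$, $i_1,\dots,i_m\in\{1,\ldots,n\}$; nonnegative means all entries are nonnegative. $(Tx^{m-1})_i=\sum_{i_2,\ldots,i_m=1}^n T_{ii_2\ldots i_m}x_{i_2}\cdots x_{i_m}$. $\lambda\in\mathbb{C}$ is an eigenvalue of $T$ if $(Tx^{m-1})_i=\lambda x_i^{m-1}$ for all $i$ for some $x\in\mathbb{C}^n\setminus\{0\}$; $\rho(T)$ is the maximum of $|\lambda|$ over all eigenvalues (for a one-dimensional nonnegative tensor $\rho$ is its single entry). For nonempty $I\subseteq\{1,\ldots,n\}$, $T_I=(T_{i_1\ldots i_m})_{i_1,\ldots,i_m\in I}$ is the induced tensor; for a matrix $A$, $A_I$ is the principal submatrix indexed by $I$. The representation $G(T)$ is the matrix whose $(i,j)$ entry is the sum of all $T_{ii_2\ldots i_m}$ over $(i_2,\ldots,i_m)$ with $j\in\{i_2,\ldots,i_m\}$. $T$ is weakly reducible if $G(T)$ is a reducible matrix, weakly irreducible otherwise; one-dimensional tensors and $1\times1$ matrices (possibly zero) are by convention (weakly) irreducible. Partition procedure: For a weakly reducible nonnegative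 tensor $S$ with index set $J$, choose a partition $\{J_1,\ldots,J_l\}$ of $J$ such that each matrix $[G(S)]_{J_i}$ is irreducible and $[G(S)]_{st}=0$ whenever $s\in J_p$, $t\in J_q$, $p>q$. Start with $S=T$. Keep each $J_i$ for which $S_{J_i}$ is weakly irreducible; for each $J_i$ for which $S_{J_i}$ is weakly reducible, apply the same step to the tensor $S_{J_i}$ (using its own representation matrix $G(S_{J_i})$), and continue recursively until all induced tensors are weakly irreducible. The process terminates after finitely many steps, and the sets kept form the partition $\{I_1,\ldots,I_k\}$. *)

(* Defs.v *)
(* finset comes after classical_sets, whose set0 and partition it shadows. *)
From mathcomp Require Import boolp classical_sets reals.
From mathcomp Require Import all_boot all_order all_algebra.
From mathcomp Require Export complex.

Set Implicit Arguments.
Unset Strict Implicit.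
Unset Printing Implicit Defensive.

Import Order.TTheory GRing.Theory Num.Theory.
Local Open Scope ring_scope.
Local Open Scope complex_scope.

(* The first index is kept apart from the tuple of the m - 1 others: the entry
   T_{i i_2 ... i_m} is T i [tuple i_2; ...; i_m]. Intended for 0 < m. *)
Definition tensor (R : Type) (m n : nat) : Type :=
  'I_n -> m.-1.-tuple 'I_n -> R.

Section Tensor.
Context {R : realType} {m : nat}.

Definition tensor_nonneg n (T : tensor R m n) : Prop := forall i s, 0 <= T i s.

Definition tensor_app n (T : tensor R m n) (x : 'cV[R[i]]_n) (i : 'I_n) : R[i] :=
  \sum_(s : m.-1.-tuple 'I_n)
     (T i s)%:C * \prod_(k < m.-1) x (tnth s k) ord0.

Definition tensor_eigenvalue n (T : tensor R m n) (l : R[i]) : Prop :=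
  exists2 x : 'cV[R[i]]_n, x != 0 &
    forall i, tensor_app T x i = l * x i ord0 ^+ m.-1.

Definition eigenvalue_moduli n (T : tensor R m n) : set R :=
  [set r | exists2 l, tensor_eigenvalue T l & r = Normc.normc l]%classic.

(* The greatest element of the set of moduli; the default value 0 is only
   used when there is none. No special case is needed in dimension one, where
   the only eigenvalue of a tensor is its single entry. *)
Definition rho n (T : tensor R m n) : R :=
  xget 0 (eigenvalue_moduli T `&` ubound (eigenvalue_moduli T))%classic.

(* The elements of I are renumbered 0, ..., #|I| - 1 by enum_val. *)
Definition induced n (T : tensor R m n) (I : {set 'I_n}) : tensor R m #|I| :=
  fun i s => T (enum_val i) (map_tuple (fun j => enum_val j) s).
#[global] Arguments induced {n} T I i s.

Definition principal_submx n (A : 'M[R]_n) (I : {set 'I_n}) : 'M[R]_#|I| :=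
  \matrix_(i, j) A (enum_val i) (enum_val j).

Definition mx_reducible n (A : 'M[R]_n) : bool :=
  [exists I : {set 'I_n}, [&& I != set0, I != [set: 'I_n] &
    [forall i in I, forall j in ~: I, A i j == 0]]].

Definition representation n (T : tensor R m n) : 'M[R]_n :=
  \matrix_(i, j) \sum_(s : m.-1.-tuple 'I_n | j \in s) T i s.

Definition weakly_reducible n (T : tensor R m n) : bool :=
  mx_reducible (representation T).

(* J p is the block number p of an ordered partition of the index set. *)
Definition block_triangular n (A : 'M[R]_n) l (J : 'I_l -> {set 'I_n}) : Prop :=
  [/\ injective J,
      partition [set J p | p : 'I_l] [set: 'I_n],
      forall p, ~~ mx_reducible (principal_submx A (J p))
    & forall p q : 'I_l, (q < p)%N ->
        forall s t, s \in J p -> t \in J q -> A s t = 0].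

(* block_partition S P: P is a possible outcome of the recursive
   block-triangularization procedure started from S. The outcome Q p of the
   recursive call on the tensor induced by J p is a set of subsets of
   'I_#|J p|, which enum_val sends back to subsets of J p. *)
Inductive block_partition :
    forall n, tensor R m n -> {set {set 'I_n}} -> Prop :=
| BlockKeep n (S : tensor R m n) :
    ~~ weakly_reducible S -> block_partition S [set [set: 'I_n]]
| BlockSplit n (S : tensor R m n) l (J : 'I_l -> {set 'I_n})
    (Q : forall p, {set {set 'I_#|J p|}}) :
    weakly_reducible S ->
    block_triangular (representation S) J ->
    (forall p, block_partition (induced S (J p)) (Q p)) ->
    block_partition S
      (\bigcup_(p < l) [set [set enum_val j | j in I] | I : {set 'I_#|J p|} in Q p]).

End Tensor.

(* Main.v *)
Require Import Defs.
From mathcomp Require Import boolp classical_sets topology normedtype.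
From mathcomp Require Import derive realfun exp.
From mathcomp Require Import all_boot all_order all_algebra.
From mathcomp Require Import reals.

Set Implicit Arguments.
Unset Strict Implicit.
Unset Printing Implicit Defensive.

Import Order.TTheory GRing.Theory Num.Theory.
Import numFieldNormedType.Exports.
Local Open Scope ring_scope.

(** Write [T x] for the vector of forms [x |-> (T x^(m-1))_i] and [d = m - 1].
    Call [(r, w)], with [w] a nonzero nonnegative real vector, subinvariant when
    [r * w_i ^ d <= (T w)_i] for all [i]. The proof compares every spectral
    radius in sight with one number: the largest [r] of a subinvariant pair of
    the whole tensor [T].

    That number is an eigenvalue of [T] ([nonneg_eigenpair]). A maximal pair
    exists by compactness of the simplex. If all entries of [T] are positive, a
    maximal pair is an eigenpair by Wielandt's argument: otherwise
    [y := (T w)^(1/d)] dominates [r^(1/d) * w], strictly somewhere, so that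
    [T y > r * y^d] in every coordinate, and [r] could be increased. For a
    nonnegative [T], the eigenpairs of the tensors [T + e] are, as [e] goes to
    0, almost eigenpairs of [T] with eigenvalue at least [r]; compactness turns
    them into an eigenpair of [T], whose eigenvalue is [r] by maximality.

    Every eigenvalue of [T] is an eigenvalue of [T_I] for some [I] in the final
    partition ([block_partition_eigenvalue]). Indeed let [J_p] be the last block
    on which an eigenvector [x] does not vanish. For [i] in [J_p], the terms of
    [(T x)_i] that involve an earlier block vanish because [G(T)_ij = 0] forces
    all entries [T_(i ... j ...)] of a nonnegative tensor to be zero, and those
    that involve a later block vanish because [x] does. Hence the restriction of
    [x] to [J_p] is an eigenvector of [T_(J_p)], and one goes on recursively.

    Conversely, if [l] is an eigenvalue of any induced tensor [T_I], the moduli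
    of an eigenvector, extended by zero, form with [|l|] a subinvariant pair of
    [T] ([eigenvalue_on_subinvariant]), so [|l| <= r]. Taking for [I] the block
    of which [r] is an eigenvalue, both [rho T] and [rho T_I] are equal to [r]. *)

(** * Homogeneous forms of a tensor *)

Definition form (K : comNzRingType) n d (A : 'I_n -> d.-tuple 'I_n -> K)
    (x : 'I_n -> K) (i : 'I_n) : K :=
  \sum_s A i s * \prod_(k < d) x (tnth s k).

Lemma eq_form (K : comNzRingType) n d (A : 'I_n -> d.-tuple 'I_n -> K) x y :
  x =1 y -> form A x =1 form A y.
Proof.
by move=> e i; apply: eq_bigr => s _; congr (_ * _); apply: eq_bigr => k _.
Qed.

Lemma formZ (K : comNzRingType) n d (A : 'I_n -> d.-tuple 'I_n -> K) c x i :
  form A (fun j => c * x j) i = c ^+ d * form A x i.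
Proof.
rewrite mulr_sumr; apply: eq_bigr => s _.
by rewrite big_split /= prodr_const card_ord mulrCA.
Qed.

Lemma form_ge0 (R : numDomainType) n d (A : 'I_n -> d.-tuple 'I_n -> R) x i :
  (forall i s, 0 <= A i s) -> (forall j, 0 <= x j) -> 0 <= form A x i.
Proof. by move=> A0 x0; apply: sumr_ge0 => s _; rewrite mulr_ge0 ?prodr_ge0. Qed.

(** This is the value of a form all of whose coefficients are 1; it makes the
    perturbation [A + e] shift the forms by a constant on the simplex. *)
Lemma sum_prod_tuple (K : comNzRingType) n d (x : 'I_n -> K) :
  \sum_(s : d.-tuple 'I_n) \prod_(k < d) x (tnth s k) = (\sum_j x j) ^+ d.
Proof.
elim: d => [|d IH].
  rewrite expr0 (eq_bigr (fun=> 1)) => [|s _]; last by rewrite big_ord0.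
  by rewrite sumr_const card_tuple expn0.
rewrite exprS -IH mulr_suml.
under [RHS]eq_bigr do rewrite mulr_sumr.
rewrite pair_big /=.
rewrite (reindex (fun p : 'I_n * d.-tuple 'I_n => [tuple of p.1 :: p.2])) /=.
  apply: eq_bigr => -[j s] _; rewrite big_ord_recl /=; congr (_ * _).
  by apply: eq_bigr => k _; rewrite tnthS.
exists (fun t : d.+1.-tuple _ => (thead t, [tuple of behead t])) => [[j s] _|t _].
  by rewrite /= theadE; congr pair; apply: val_inj.
by rewrite -tuple_eta.
Qed.

(** * Subinvariant pairs and their compactness *)

Section Subinvariant.
Context {R : realType} {n d : nat}.
Implicit Types (A : 'I_n -> d.-tuple 'I_n -> R) (w : 'I_n -> R) (r : R).

Definition subinvariant A r w : Prop :=
  [/\ forall i, 0 <= w i, exists i, w i != 0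
    & forall i, r * w i ^+ d <= form A w i].

(** Compare both sides at a coordinate where [w] is largest: there every monomial
    is at most [w_i ^ d]. *)
Lemma subinvariant_le A r w : (forall i s, 0 <= A i s) ->
  subinvariant A r w -> r <= \sum_i \sum_s A i s.
Proof.
move=> A0 [w0 [j wj] rw].
case: (@arg_maxP _ _ _ j xpredT w) => // i _ imax.
have wi : 0 < w i by apply: lt_le_trans (imax j _); rewrite // lt_def wj w0.
have : r * w i ^+ d <= (\sum_s A i s) * w i ^+ d.
  apply: le_trans (rw i) _; rewrite mulr_suml; apply: ler_sum => s _.
  apply: ler_wpM2l => //.
  rewrite -[X in _ <= w i ^+ X]card_ord -prodr_const.
  by apply: ler_prod => k _; rewrite w0 /=; apply: imax.
rewrite ler_pM2r ?exprn_gt0 // => /le_trans; apply.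
by rewrite (bigD1 i) //= lerDl sumr_ge0 // => k _; apply: sumr_ge0.
Qed.

Lemma subinvariant_mono A B r w : (forall i s, A i s <= B i s) ->
  subinvariant A r w -> subinvariant B r w.
Proof.
move=> AB [w0 wn rw]; split=> // i; apply: le_trans (rw i) _.
by apply: ler_sum => s _; apply: ler_wpM2r => //; apply: prodr_ge0.
Qed.

Definition simplex : set 'rV[R]_n :=
  [set z | (forall i, 0 <= z ord0 i) /\ \sum_i z ord0 i = 1]%classic.

Lemma simplex_neq0 (z : 'rV[R]_n) : simplex z -> exists i, z ord0 i != 0.
Proof.
move=> [z0 z1]; apply/existsP; apply: contraT => /existsPn z00.
move/eqP: z1; rewrite big1 ?(eq_sym 0) ?oner_eq0 // => i _.
by apply/eqP; have := z00 i; rewrite negbK.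
Qed.

Lemma subinvariant_simplex A r w : subinvariant A r w ->
  exists2 z : 'rV[R]_n, simplex z &
    forall i, r * z ord0 i ^+ d <= form A (z ord0) i.
Proof.
move=> [w0 [j wj] rw]; pose c := \sum_i w i.
have c0 : 0 < c.
  rewrite /c (bigD1 j) //= ltr_pwDl ?sumr_ge0 // lt_def wj w0 //.
exists (\row_i (c^-1 * w i)).
  split=> [i|]; first by rewrite mxE mulr_ge0 // invr_ge0 ltW.
  under eq_bigr do rewrite mxE.
  by rewrite -mulr_sumr mulVf // gt_eqF.
move=> i; rewrite (@eq_form _ _ _ A _ (fun j => c^-1 * w j)); last first.
  by move=> ?; rewrite mxE.
rewrite formZ mxE exprMn mulrCA ler_pM2l ?rw //.
by rewrite exprn_gt0 // invr_gt0.
Qed.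

Local Open Scope classical_set_scope.

Lemma coord1_continuous j :
  continuous (fun p : 'rV[R]_n * R => p.1 ord0 j).
Proof.
move=> p; apply: (@continuous_comp _ _ _ fst (fun z : 'rV[R]_n => z ord0 j)).
  exact: cvg_fst.
exact: coord_continuous.
Qed.

Lemma sum_coord_continuous : continuous (fun z : 'rV[R]_n => \sum_i z ord0 i).
Proof.
apply: continuous_big; first exact: add_continuous.
by move=> i _; apply: coord_continuous.
Qed.

Lemma form_continuous A i :
  continuous (fun p : 'rV[R]_n * R => form A (p.1 ord0) i).
Proof.
apply: continuous_big; first exact: add_continuous.
move=> s _ p; apply: continuousM; first exact: cst_continuous.
move: p; apply: continuous_big; first exact: mul_continuous.
by move=> k _; apply: coord1_continuous.
Qed.

Lemma gap_continuous A i :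
  continuous (fun p : 'rV[R]_n * R =>
    form A (p.1 ord0) i - p.2 * p.1 ord0 i ^+ d).
Proof.
move=> p; apply: cvgB; first exact: form_continuous.
apply: cvgM; first exact: cvg_snd.
apply: (@continuous_comp _ _ _ _ (fun a : R => a ^+ d)).
  exact: coord1_continuous.
exact: exprn_continuous.
Qed.

Lemma simplex_compact : compact simplex.
Proof.
apply: (@subclosed_compact _ _
  [set z : 'rV[R]_n | forall i, `[0, 1]%classic (z ord0 i)]).
- have -> : simplex =
    (\bigcap_i (fun z : 'rV[R]_n => z ord0 i) @^-1` [set t | 0 <= t])
    `&` (fun z : 'rV[R]_n => \sum_i z ord0 i) @^-1` [set 1].
    apply/seteqP; split=> z [z0 z1]; split=> // i; first by move=> _; apply: z0.
    exact: (z0 i I).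
  apply: closedI.
    apply: closed_bigI => i _; apply: preimage_closed; last exact: closed_ge.
    by move=> z _; apply: coord_continuous.
  apply: preimage_closed; last exact: closed_eq.
  by move=> z _; apply: sum_coord_continuous.
- apply: (@rV_compact R n (fun=> `[0, 1]%classic)) => _.
  exact: segment_compact.
- move=> z [z0 z1] i /=; rewrite in_itv /= z0 -z1 (bigD1 i) //= lerDl.
  by apply: sumr_ge0.
Qed.

Lemma simplex_nonempty : (0 < n)%N -> simplex !=set0.
Proof.
move=> n0; exists (\row_i (i == Ordinal n0)%:R); split=> [i|].
  by rewrite mxE ler0n.
under eq_bigr do rewrite mxE.
by rewrite (bigD1 (Ordinal n0)) //= big1 ?addr0 // => i /negPf ->.
Qed.

(** The pairs [(z, r)] with [z] in the simplex, [0 <= r] and [r * z^d <= A z] form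
    a compact set, because [subinvariant_le] bounds [r]. *)
Lemma subinvariant_max A : (0 < n)%N -> (forall i s, 0 <= A i s) ->
  exists r (z : 'rV[R]_n), [/\ 0 <= r, simplex z, subinvariant A r (z ord0)
    & forall r' w, subinvariant A r' w -> r' <= r].
Proof.
move=> n0 A0; pose b := \sum_i \sum_s A i s.
have b0 : 0 <= b by apply: sumr_ge0 => i _; apply: sumr_ge0.
pose gap i (p : 'rV[R]_n * R) := form A (p.1 ord0) i - p.2 * p.1 ord0 i ^+ d.
pose C := (simplex `*` `[0, b]) `&` \bigcap_i (gap i @^-1` [set t | 0 <= t]).
have Cn : C !=set0.
  have [z zS] := simplex_nonempty n0; have [z0 _] := zS.
  exists (z, 0); split; first by split=> //=; rewrite in_itv /= lexx.
  by move=> i _; rewrite /gap /= mul0r subr0; apply: form_ge0.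
have Cc : compact C.
  apply: (@subclosed_compact _ _ (simplex `*` `[0, b])).
  - apply: closedI.
      apply: compact_closed; last first.
        by apply: compact_setX; [exact: simplex_compact|exact: segment_compact].
      exact: norm_hausdorff.
    apply: closed_bigI => i _; apply: preimage_closed; last exact: closed_ge.
    by move=> p _; apply: gap_continuous.
  - by apply: compact_setX; [exact: simplex_compact|exact: segment_compact].
  - by move=> p [].
have snd_cont : {within C, continuous (fun p : 'rV[R]_n * R => p.2)}.
  by apply: continuous_subspaceT => p; apply: cvg_snd.
have [[z r] /set_mem [[/= zS rb] zr] rmax] := compact_EVT_max Cn Cc snd_cont.
exists r, z; split=> //.
- by move: rb; rewrite in_itv /= => /andP[].
- split; [by case: zS|exact: simplex_neq0|move=> i].
  by have := zr i I; rewrite /gap /= subr_ge0.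
move=> r' w rw; have [r'0|r'0] := ltP r' 0.
  by move: rb; rewrite in_itv /= => /andP[/(lt_le_trans r'0)/ltW].
have [z' z'S z'r] := subinvariant_simplex rw.
apply: (rmax (z', r')); apply/mem_set; split.
  by split=> //=; rewrite in_itv /= r'0 (subinvariant_le A0 rw).
by move=> i _; rewrite /gap /= subr_ge0.
Qed.

(** * Perron-Frobenius eigenpairs *)

Lemma nthroot_exists (a : R) : (0 < d)%N -> 0 <= a ->
  exists2 y : R, 0 <= y & y ^+ d = a.
Proof.
move=> d0 a0; exists (a `^ d%:R^-1); first exact: powR_ge0.
by rewrite -powR_mulrn ?powR_ge0 // -powRrM mulVf ?powRr1 // pnatr_eq0 -lt0n.
Qed.

Lemma strict_subinvariant A r w : (forall i, 0 <= w i) -> (exists i, w i != 0) ->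
  (forall i, r * w i ^+ d < form A w i) -> exists2 r', r < r' & subinvariant A r' w.
Proof.
move=> w0 wn rw.
pose e i := (form A w i - r * w i ^+ d) / (1 + w i ^+ d).
have p0 i : 0 < 1 + w i ^+ d by rewrite ltr_pwDl ?exprn_ge0.
exists (r + \big[Num.min/1]_i e i).
  rewrite ltrDl; apply: lt_bigmin => // i _.
  by rewrite divr_gt0 // subr_gt0.
split=> // i; rewrite mulrDl -lerBrDl.
have ei0 : 0 <= e i by rewrite ltW // divr_gt0 // subr_gt0.
apply: (@le_trans _ _ (e i * (1 + w i ^+ d))).
  apply: (@le_trans _ _ (e i * w i ^+ d)).
    by apply: ler_wpM2r; rewrite ?exprn_ge0 ?bigmin_le.
  by apply: ler_wpM2l; rewrite ?lerDr.
by rewrite /e mulfVK // gt_eqF.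
Qed.

(** Wielandt's argument. If [r * w^d <= A w] were strict at [i0], the vector [y]
    with [y^d = A w] would satisfy [r * y^d = A (c * w) < A y] everywhere, where
    [c^d = r]: every form of a positive tensor contains the monomial
    [x_i0 ^ d], on which [y] is strictly larger than [c * w]. Then
    [strict_subinvariant] contradicts the maximality of [r]. *)
Lemma positive_eigenpair A r w : (0 < d)%N -> (forall i s, 0 < A i s) -> 0 <= r ->
  subinvariant A r w -> (forall r' w', subinvariant A r' w' -> r' <= r) ->
  forall i, form A w i = r * w i ^+ d.
Proof.
move=> d0 A0 r0 [w0 [l wl] rw] rmax i0; apply/eqP; rewrite eq_le rw andbT leNgt.
apply/negP => ri0.
have A0' i s : 0 <= A i s by apply: ltW.
have Aw0 i : 0 <= form A w i by apply: form_ge0.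
have /choice[y yE] i : exists y : R, 0 <= y /\ y ^+ d = form A w i.
  by have [y ? ?] := nthroot_exists d0 (Aw0 i); exists y.
have y0 i : 0 <= y i by case: (yE i).
have yd i : y i ^+ d = form A w i by case: (yE i).
have [c c0 cd] := nthroot_exists d0 r0.
have cwy i : c * w i <= y i.
  rewrite -(ler_pXn2r d0) ?nnegrE ?mulr_ge0 //.
  by rewrite exprMn cd yd.
have yi0 : 0 < y i0.
  rewrite lt_def y0 andbT; apply: contraTneq ri0 => yi0.
  by rewrite -leNgt -yd yi0 expr0n eqn0Ngt d0 /= mulr_ge0 ?exprn_ge0.
have lt_form i : r * y i ^+ d < form A y i.
  rewrite yd -cd -formZ; pose s0 := [tuple of nseq d i0].
  rewrite /form (bigD1 s0) //= [ltRHS](bigD1 s0) //=.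
  apply: ltr_leD.
    rewrite ltr_pM2l //.
    rewrite (eq_bigr (fun=> c * w i0)) => [|k _]; last by rewrite tnth_nseq.
    rewrite [ltRHS](eq_bigr (fun=> y i0)) => [|k _]; last by rewrite tnth_nseq.
    by rewrite !prodr_const card_ord exprMn cd yd.
  apply: ler_sum => s _; apply: ler_wpM2l => //.
  by apply: ler_prod => k _; rewrite mulr_ge0 //= cwy.
have [|r' rr' /rmax] := strict_subinvariant y0 _ lt_form.
  by exists i0; rewrite gt_eqF.
by rewrite leNgt rr'.
Qed.

(** The sum of the gaps [|(A z)_i - r * z_i ^ d|] attains its minimum on the
    compact set of the pairs [(z, r)] with [z] in the simplex and [r] between the
    maximal value [r0] and a bound [b]. The minimum is 0 because a maximal pair of
    [A + e] has all its gaps equal to [e]. *)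
Lemma nonneg_eigenpair A : (0 < n)%N -> (0 < d)%N -> (forall i s, 0 <= A i s) ->
  exists r w, [/\ 0 <= r, subinvariant A r w,
    forall i, form A w i = r * w i ^+ d
    & forall r' w', subinvariant A r' w' -> r' <= r].
Proof.
move=> n0 d0 A0.
have [r0 [z0 [r0_ge0 z0S z0r r0max]]] := subinvariant_max n0 A0.
(* [b] bounds the eigenvalues of [A + e] uniformly for [e <= 1]. *)
pose b := \sum_(i < n) \sum_s (A i s + 1).
pose gap i (p : 'rV[R]_n * R) := form A (p.1 ord0) i - p.2 * p.1 ord0 i ^+ d.
pose C := simplex `*` `[r0, b].
have AD e : 0 < e -> e <= 1 -> exists p, C p /\ forall i, `|gap i p| = e.
  move=> e0 e1; pose B i (s : d.-tuple 'I_n) := A i s + e.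
  have AB i s : A i s <= B i s by rewrite lerDl ltW.
  have B0 i s : 0 < B i s by rewrite ltr_wpDl.
  have [r [z [r_ge0 zS zr rmax]]] := subinvariant_max n0 (fun i s => ltW (B0 i s)).
  have eig := positive_eigenpair d0 B0 r_ge0 zr rmax.
  exists (z, r); split=> [|i].
    split=> //=; rewrite in_itv /=; apply/andP; split.
      by apply: rmax; apply: subinvariant_mono AB z0r.
    apply: le_trans (subinvariant_le (fun i s => ltW (B0 i s)) zr) _.
    by apply: ler_sum => i _; apply: ler_sum => s _; rewrite lerD2l.
  have -> : gap i (z, r) = - e.
    rewrite /gap /= -eig -[X in _ = - X]mulr1 -[1](expr1n _ d) -zS.2.
    rewrite -sum_prod_tuple mulr_sumr -sumrB -sumrN.
    by apply: eq_bigr => s _; rewrite /B mulrDl opprD addrA subrr add0r.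
  by rewrite normrN gtr0_norm.
have gap_cont : continuous (fun p => \sum_i `|gap i p|).
  apply: continuous_big; first exact: add_continuous.
  by move=> i _ p; apply: cvg_norm; apply: gap_continuous.
have Cn : C !=set0 by have [p [pC _]] := AD 1 ltr01 (lexx 1); exists p.
have Cc : compact C.
  by apply: compact_setX; [exact: simplex_compact|exact: segment_compact].
have [[z r] /set_mem[/= zS rb] pmin] :=
  compact_EVT_min Cn Cc (continuous_subspaceT gap_cont).
move: rb; rewrite in_itv /= => /andP[r0r _].
have sum0 : \sum_i `|gap i (z, r)| <= 0.
  rewrite leNgt; apply/negP => s0.
  (* With this [e], the pair of [AD] would have gap sum at most half the minimum. *)
  pose e := Num.min 1 ((\sum_i `|gap i (z, r)|) / (2 * n%:R)).
  have n0' : (0 : R) < n%:R by rewrite ltr0n.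
  have [||p [pC pE]] := AD e.
  - by rewrite lt_min ltr01 divr_gt0 // mulr_gt0.
  - by rewrite ge_min lexx.
  have := pmin p (mem_set pC).
  rewrite (eq_bigr (fun=> e) (fun i _ => pE i)) sumr_const card_ord.
  apply/negP; rewrite -ltNge -mulr_natr.
  apply: (@le_lt_trans _ _ ((\sum_i `|gap i (z, r)|) / (2 * n%:R) * n%:R)).
    apply: ler_wpM2r; first by rewrite ler0n.
    by rewrite ge_min lexx orbT.
  rewrite invfM mulrA mulfVK ?gt_eqF //.
  by rewrite ltr_pdivrMr // mulr_natr mulr2n ltrDl.
have eig i : form A (z ord0) i = r * z ord0 i ^+ d.
  apply/eqP; rewrite -subr_eq0 -normr_le0; apply: le_trans sum0.
  by rewrite (bigD1 i) //= lerDl sumr_ge0.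
exists r, (z ord0); split=> //; first exact: le_trans r0r.
  by split=> [||i]; [case: zS|exact: simplex_neq0|rewrite eig].
by move=> r' w' /r0max /le_trans; apply.
Qed.

End Subinvariant.

(** * Restriction to index sets and block-triangular tensors *)

(** The tuples with an entry outside the range of [h] contribute 0. *)
Lemma sum_supported (K : comNzRingType) a b d (h : 'I_a -> 'I_b)
    (F : d.-tuple 'I_b -> K) (y : 'I_b -> K) :
  injective h -> (forall i, i \notin codom h -> y i = 0) ->
  \sum_s F s * \prod_(k < d) y (tnth s k) =
  \sum_(t : d.-tuple 'I_a) F (map_tuple h t) * \prod_(k < d) y (h (tnth t k)).
Proof.
move=> h_inj y0; pose D := [set map_tuple h t | t : d.-tuple 'I_a].
have map_inj : injective (fun t : d.-tuple 'I_a => map_tuple h t).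
  by move=> t u /(congr1 val) /= /(inj_map h_inj)/val_inj.
rewrite (bigID (mem D)) /= [X in _ + X]big1 ?addr0 => [|s sD]; last first.
  have [k sk] : exists k, tnth s k \notin codom h.
    apply/existsP; apply: contraNT sD => /existsPn sh.
    have sh' k : tnth s k \in codom h by have := sh k; rewrite negbK.
    apply/imsetP; exists [tuple iinv (sh' k) | k < d] => //.
    by apply: eq_from_tnth => k; rewrite tnth_map tnth_mktuple f_iinv.
  by rewrite (bigD1 k) //= y0 // mul0r mulr0.
rewrite big_imset /=; last by move=> t u _ _ /map_inj.
apply: eq_big => [t|t _]; first by rewrite inE.
by congr (_ * _); apply: eq_bigr => k _; rewrite tnth_map.
Qed.

(** An eigenvector of an induced tensor, extended by zero, is a vector on the
    whole index set that vanishes outside [I] and satisfies the eigenvalue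
    equations of the whole tensor at the indices in [I]. This form of the notion
    needs no renumbering of [I], so it composes along nested restrictions. *)
Definition eigenvalue_on (K : comNzRingType) n d
    (A : 'I_n -> d.-tuple 'I_n -> K) (I : {set 'I_n}) (l : K) : Prop :=
  exists x : 'I_n -> K, [/\ exists i, x i != 0, forall i, i \notin I -> x i = 0
    & forall i, i \in I -> form A x i = l * x i ^+ d].

Section Blocks.
Context {K : comNzRingType} {n d : nat}.
Implicit Types (A : 'I_n -> d.-tuple 'I_n -> K) (I : {set 'I_n}) (l : K).

(** The same operation as [induced], over any ring: it is needed for the complex
    tensor whose entries are those of a real one. *)
Definition restriction A I (i : 'I_#|I|) (s : d.-tuple 'I_#|I|) : K :=
  A (enum_val i) (map_tuple (fun j => enum_val j) s).

Lemma codom_enum_val I i : (i \in codom (fun j : 'I_#|I| => enum_val j)) = (i \in I).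
Proof.
apply/codomP/idP => [[j ->]|iI]; first exact: enum_valP.
by exists (enum_rank_in iI i); rewrite enum_rankK_in.
Qed.

Lemma form_restriction A I (x : 'I_n -> K) j : (forall i, i \notin I -> x i = 0) ->
  form (restriction A (I := I)) (fun j => x (enum_val j)) j = form A x (enum_val j).
Proof.
move=> x0; rewrite /form (sum_supported (h := fun j : 'I_#|I| => enum_val j)) //.
  exact: enum_val_inj.
by move=> i; rewrite codom_enum_val; apply: x0.
Qed.

Lemma eigenvalue_on_restriction A I (I' : {set 'I_#|I|}) l :
  eigenvalue_on (restriction A (I := I)) I' l <->
  eigenvalue_on A [set enum_val j | j in I'] l.
Proof.
split=> [[x [[j xj] x0 xl]]|[x [[i xi] x0 xl]]].
  pose y i := \sum_(j : 'I_#|I| | enum_val j == i) x j.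
  have yE j' : y (enum_val j') = x j'.
    by rewrite /y (big_pred1 j') // => k /=; rewrite (inj_eq enum_val_inj).
  have y0 i : i \notin I -> y i = 0.
    by move=> iI; apply: big1 => k /eqP ki; rewrite -ki enum_valP in iI.
  exists y; split=> [|i iI|_ /imsetP[j' j'I ->]].
  - by exists (enum_val j); rewrite yE.
  - have [/codomP[j' ij']|] := boolP (i \in codom (fun j : 'I_#|I| => enum_val j)).
      rewrite ij' yE x0 //; apply: contraNN iI => j'I.
      by rewrite ij'; apply/imsetP; exists j'.
    by rewrite codom_enum_val => /y0.
  - rewrite -form_restriction // yE -xl //.
    exact: eq_form.
have x0' i' : i' \notin I -> x i' = 0.
  by move=> iI; apply: x0; apply: contraNN iI => /imsetP[j _ ->]; apply: enum_valP.
exists (fun j => x (enum_val j)); split=> [|j jI|j jI].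
- have /imsetP[j _ ij] : i \in [set enum_val j | j in I'].
    by apply: contraNT xi => /x0 ->.
  by exists j; rewrite -ij.
- by apply: x0; apply: contraNN jI => /imsetP[k kI /enum_val_inj ->].
- by rewrite form_restriction // xl //; apply/imsetP; exists j.
Qed.

(** The required block is the last one on which the eigenvector [x] is not zero.
    For [i] in it, a monomial of [(A x)_i] with an index outside the block has a
    zero coefficient if the index lies in an earlier block, and a zero factor of
    [x] if it lies in a later one. *)
Lemma eigenvalue_on_block A l (q : nat) (J : 'I_q -> {set 'I_n}) :
  (forall i, exists p, i \in J p) ->
  (forall p p' : 'I_q, (p' < p)%N -> forall i j (s : d.-tuple 'I_n),
    i \in J p -> j \in J p' -> j \in s -> A i s = 0) ->
  eigenvalue_on A [set: 'I_n] l -> exists p, eigenvalue_on A (J p) l.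
Proof.
move=> Jcover Jtri [x [[i0 xi0] _ xl]].
have [p0 i0p0] := Jcover i0.
pose P p := [exists i in J p, x i != 0].
have Pp0 : P p0 by apply/existsP; exists i0; rewrite i0p0.
case: (@arg_maxnP _ p0 P (fun p => nat_of_ord p) Pp0) => p.
move=> /existsP[i1 /andP[i1p xi1]] pmax.
exists p, (fun i => if i \in J p then x i else 0); split=> [|i|i ip].
- by exists i1; rewrite i1p.
- by move/negbTE ->.
- rewrite ip -xl ?inE //; apply: eq_bigr => s _.
  have [sJ|] := boolP [forall k, tnth s k \in J p].
    by congr (_ * _); apply: eq_bigr => k _; rewrite (forallP sJ).
  move=> /forallPn[k skp].
  rewrite (bigD1 k) //= (negbTE skp) mul0r mulr0.
  have [p' skp'] := Jcover (tnth s k).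
  have [pp'|pp'] := ltnP p' p.
    by rewrite (Jtri _ _ pp' _ _ _ ip skp') ?mul0r ?mem_tnth.
  suff xk : x (tnth s k) = 0 by rewrite (bigD1 k) //= xk mul0r mulr0.
  apply/eqP; apply: contraT => xk.
  have /pmax p'p : P p' by apply/existsP; exists (tnth s k); rewrite skp'.
  have pE : p' = p by apply/val_inj/anti_leq; rewrite pp' andbT; exact: p'p.
  by move: skp; rewrite -pE skp'.
Qed.

End Blocks.

(** * Spectral radii of induced tensors *)

Section Spectrum.
Context {R : realType}.
Local Open Scope complex_scope.

Definition complexify m n (T : tensor R m n) (i : 'I_n)
    (s : m.-1.-tuple 'I_n) : R[i] :=
  (T i s)%:C.

Lemma tensor_eigenvalueE m n (T : tensor R m n) l :
  tensor_eigenvalue T l <-> eigenvalue_on (complexify T) [set: 'I_n] l.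
Proof.
split=> [[x xn xl]|[x [[i xi] _ xl]]].
  exists (fun i => x i ord0); split=> [|i|i _]; last exact: xl.
    have /existsP // : [exists i, x i ord0 != 0].
    apply: contraNT xn => /existsPn x0; apply/eqP/colP => i.
    by rewrite mxE; apply/eqP; have := x0 i; rewrite negbK.
  by rewrite inE.
exists (\col_i x i).
  by apply: contraNneq xi => /colP/(_ i); rewrite !mxE => ->.
move=> j; rewrite mxE -xl ?inE //.
apply: (@eq_form _ _ _ (complexify T) (fun k => (\col_i x i) k ord0) x) => k.
by rewrite mxE.
Qed.

Lemma induced_eigenvalueE m n (T : tensor R m n) I l :
  tensor_eigenvalue (induced T I) l <-> eigenvalue_on (complexify T) I l.
Proof.
rewrite tensor_eigenvalueE.
have I_image : [set enum_val j | j in [set: 'I_#|I|]] = I.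
  apply/setP => i; rewrite -[RHS]codom_enum_val.
  by apply/imsetP/codomP => [[j _ ->]|[j ->]]; exists j.
have := eigenvalue_on_restriction (complexify T) [set: 'I_#|I|] l.
by rewrite I_image.
Qed.

(** Induction on the recursive procedure. Since a vanishing entry [G(S)_ij] is a
    vanishing sum of nonnegative terms, it yields the zero entries of [S] that
    [eigenvalue_on_block] requires. *)
Lemma block_partition_eigenvalue m n (T : tensor R m n) P l :
  block_partition T P -> tensor_nonneg T ->
  eigenvalue_on (complexify T) [set: 'I_n] l ->
  exists2 I, I \in P & eigenvalue_on (complexify T) I l.
Proof.
elim=> {n T P} [n S _|n S q J Q _ [_ /and3P[/eqP Jcover _ _] _ Jtri] _ IH] S0 Sl.
  by exists [set: 'I_n]; rewrite ?inE.
have [|p p' pp' i j s ip jp' js|p pl] := eigenvalue_on_block _ _ Sl (J := J).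
- move=> i; have : i \in cover [set J p | p : 'I_q] by rewrite Jcover inE.
  by move=> /bigcupP[_ /imsetP[p _ ->] ip]; exists p.
- have /eqP := Jtri _ _ pp' _ _ ip jp'; rewrite mxE psumr_eq0; last first.
    by move=> t _; apply: S0.
  move=> /allP/(_ s); rewrite mem_index_enum js => /(_ isT) /eqP Sis.
  by rewrite /complexify Sis.
have [||I' I'Q I'l] := IH p.
- by move=> i s; apply: S0.
- by rewrite -tensor_eigenvalueE induced_eigenvalueE.
exists [set enum_val j | j in I'].
  by apply/bigcupP; exists p => //; apply/imsetP; exists I'.
exact/(eigenvalue_on_restriction (complexify S)).
Qed.

Lemma normc_real (r : R) : 0 <= r -> Normc.normc r%:C = r.
Proof. by move=> r0; rewrite /Normc.normc /= expr0n addr0 sqrtr_sqr ger0_norm. Qed.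

(** Take for [w] the moduli of the eigenvector and use the triangle inequality in
    the equations at [I]. Outside [I] the vector is zero, and the inequality
    holds there because [T] is nonnegative. *)
Lemma eigenvalue_on_subinvariant m n (T : tensor R m n) I l : (0 < m.-1)%N ->
  tensor_nonneg T -> eigenvalue_on (complexify T) I l ->
  exists w, subinvariant T (Normc.normc l) w.
Proof.
move=> d0 T0 [x [[i0 xi0] x0 xl]].
have normE (z : R[i]) : (Normc.normc z)%:C = `|z| by [].
have n0 (z : R[i]) : 0 <= Normc.normc z by rewrite -ler0c normE.
exists (fun i => Normc.normc (x i)); split=> // [|i].
  by exists i0; rewrite -(inj_eq (@complexI R)) normE normr_eq0.
have [iI|iI] := boolP (i \in I); last first.
  rewrite x0 // Normc.normc0 expr0n gtn_eqF // mulr0; exact: form_ge0.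
rewrite -lecR rmorphM rmorphXn /= !normE -normrX -normrM -xl //.
apply: le_trans (ler_norm_sum _ _ _) _; rewrite rmorph_sum /=.
apply: ler_sum => s _; rewrite normrM normr_prod rmorphM rmorph_prod /=.
by rewrite /complexify ger0_norm // ler0c.
Qed.

Lemma rho_eq m n (T : tensor R m n) r :
  (exists2 l, tensor_eigenvalue T l & r = Normc.normc l) ->
  (forall l, tensor_eigenvalue T l -> Normc.normc l <= r) -> rho T = r.
Proof.
move=> Tr rmax; have rub : ubound (eigenvalue_moduli T) r by move=> _ [l /rmax ? ->].
apply: xget_unique; first by split.
by move=> r' [r'T r'ub]; apply/eqP; rewrite eq_le rub //= r'ub.
Qed.

End Spectrum.

Theorem theorem5p3 (R : realType) (m n : nat) (hm : (2 <= m)%N) (hn : (2 <= n)%N)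
    (T : tensor R m n) (T_ge0 : tensor_nonneg T) (T_red : weakly_reducible T)
    (P : {set {set 'I_n}}) (hP : block_partition T P) :
  exists2 I : {set 'I_n}, I \in P & rho T = rho (induced T I).
Proof.
have d0 : (0 < m.-1)%N by case: m hm {T T_ge0 T_red hP} => [|[]].
have [r [w [r0 [_ [i wi] _] wr rmax]]] := nonneg_eigenpair (ltnW hn) d0 T_ge0.
have rT : eigenvalue_on (complexify T) [set: 'I_n] (real_complex R r).
  exists (fun i => real_complex R (w i)); split=> [|j|j _].
  - by exists i; rewrite -(inj_eq (@complexI R)) in wi.
  - by rewrite inE.
  - rewrite -rmorphXn -rmorphM -wr rmorph_sum; apply: eq_bigr => s _.
    by rewrite rmorphM rmorph_prod.
have [I IP rI] := block_partition_eigenvalue hP T_ge0 rT.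
have le_r J l : eigenvalue_on (complexify T) J l -> Normc.normc l <= r.
  by move=> /(eigenvalue_on_subinvariant d0 T_ge0)[v /rmax].
exists I => //; rewrite (rho_eq (r := r)); [rewrite (rho_eq (r := r)) //| |].
- by exists (real_complex R r); [apply/induced_eigenvalueE|rewrite normc_real].
- by move=> l /induced_eigenvalueE/le_r.
- by exists (real_complex R r); [apply/tensor_eigenvalueE|rewrite normc_real].
- by move=> l /tensor_eigenvalueE/le_r.
Qed.
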